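(* Fix $0<\rho<2$, $C>0$, a reference sequence $a^\circ\in\mathcal K_\rho(C)$ and $b_M\downarrow0$, and let $$\mathcal K(a^\circ,b)=\Big\{a\in\mathcal K_\rho(C):\ \sup_{j>M}j^{1/\rho}|a_j-a_j^\circ|\le b_M\quad(M\ge1)\Big\}.$$ This class is compact and complete in the metric $d_\rho^{\rm rk}(a,a')=\sup_jj^{1/\rho}|a_j-a'_j|$. On it, $d_\rho^{\rm rk}$ and the weak-ideal difference $d_\rho$ give the same uniformity, with $$d_\rho(a,a')\le d_\rho^{\rm rk}(a,a'),\qquad d_\rho^{\rm rk}(a,a')\le\inf_{M\ge1}\max\{M^{1/\rho}d_\rho(a,a'),\,2b_M\}.$$ The full invariant map $J(a)=(E_k(a))_{k\ge1}$ (coordinate product uniformity on the data) has a uniformly continuous inverse on its closed image. Explicitly, for every $n\ge1$ and $a,a'\in\mathcal K(a^\circ,b)$, $$d_\rho(a,a')\le\inf_{M\ge1}\max\{M^{1/\rho}C\,H_n(a,a'),\,2b_M\}.$$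
   Context: $\mathcal K_\rho(C)=\{a_1\ge a_2\ge\cdots\ge0:\ a_j\le Cj^{-1/\rho}\ \forall j\}$. $d_\rho(a,a')=\sup_{k\ge1}k^{1/\rho}(|a-a'|)^*_k$ with $(\cdot)^*$ the decreasing rearrangement. $E_k(a)=e_k(x)$, the $k$-th elementary symmetric function of $x_j=(a_j/C)^2$. With also $x'_j=(a'_j/C)^2$: $\mu_x=\sum_jx_j\delta_{x_j}$, $\beta_{k,n}(x)=\int\binom nkt^k(1-t)^{n-k}\,d\mu_x(t)$, $q_n(a,a')=\sum_{k=0}^n|\beta_{k,n}(x)-\beta_{k,n}(x')|$, $S_\rho=2/(2-\rho)$, $H_n(a,a')=\min\{1,(q_n(a,a')+4S_\rho/\sqrt n)^{1/4}\}$. *)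

(* Defs.v *)
From HB Require Import structures.
From mathcomp Require Import all_boot all_order all_algebra.
From mathcomp Require Import finmap.
From mathcomp Require Import all_classical all_reals all_analysis.

Set Implicit Arguments.
Unset Strict Implicit.
Unset Printing Implicit Defensive.

Import Order.TTheory GRing.Theory Num.Theory.
Import numFieldNormedType.Exports.

Local Open Scope classical_set_scope.
Local Open Scope card_scope.
Local Open Scope ring_scope.

(* Sequences a_1, a_2, ... are functions nat -> R shifted by one: [a j] is
   a_{j+1}, and [E_inv C a k] likewise is E_{k+1}(a).  Only the tail bounds
   b_M keep their own index M >= 1 (the value [b 0] is never used). *)

Section weak_ideal.
Context {R : realType}.
Implicit Types (rho C t : R) (a u x b : nat -> R) (j k n M : nat).

(* j^(1/rho), at the shifted index *)
Definition weight rho j : R := j.+1%:R `^ rho^-1.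

Definition weak_class rho C : set (nat -> R) :=
  [set a | [/\ forall i j, (i <= j)%N -> a j <= a i,
               forall j, 0 <= a j &
               forall j, a j <= C * j.+1%:R `^ (- rho^-1)]].

(* [rearr u k] is u^*_{k+1} = inf {t >= 0 : #{j : u_j > t} < k + 1}; its value
   lies in \bar R, so that unbounded sequences get +oo. *)
Definition rearr u k : \bar R :=
  ereal_inf [set t%:E | t in
    [set t | 0 <= t /\ [set j | t < u j] #<= `I_k]].

Definition d_weak rho a a' : \bar R :=
  ereal_sup (range (fun k =>
    ((weight rho k)%:E * rearr (fun j => `|a j - a' j|%R) k)%E)).

Definition d_rk rho a a' : \bar R :=
  ereal_sup (range (fun j => (weight rho j * `|a j - a' j|)%:E)).

(* The condition j > M reads [M <= j] at the shifted index. *)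
Definition tail_class rho C a0 b : set (nat -> R) :=
  [set a | weak_class rho C a /\
    forall M, (1 <= M)%N ->
      (ereal_sup [set (weight rho j * `|a j - a0 j|)%:E | j in
                   [set j | (M <= j)%N]] <= (b M)%:E)%E].

Definition sqs C a j : R := (a j / C) ^+ 2.

(* Elementary symmetric function of infinitely many nonnegative variables: the
   unordered sum over k-element sets of indices.  On the class it is finite,
   being at most (\sum_j x_j)^k / k!, so that [fine] loses nothing there. *)
Definition esymm x k : R :=
  fine (\esum_(A in [set A : {fset nat} | #|` A| = k])
          (\prod_(j <- A) x j)%:E).

Definition E_inv C a : {ptws nat -> R} := fun k => esymm (sqs C a) k.+1.

(* mu_x = \sum_j x_j \d_(x_j) *)
Definition mu_sq C a : {measure set R -> \bar R} :=
  mseries (fun j => mscale (NngNum (sqr_ge0 (a j / C))) \d_(sqs C a j)) 0.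

Definition bern C a k n : R :=
  \int[mu_sq C a]_t ('C(n, k)%:R * t ^+ k * (1 - t) ^+ (n - k)).

Definition q_bern C n a a' : R :=
  \sum_(k < n.+1) `|bern C a k n - bern C a' k n|.

Definition S_const rho : R := 2 / (2 - rho).

Definition H_bern rho C n a a' : R :=
  Num.min 1
    ((q_bern C n a a' + 4 * S_const rho / Num.sqrt n%:R) `^ (4^-1)).

Definition tail_space rho C a0 b : Type := set_type (tail_class rho C a0 b).

Definition seq_of rho C a0 b (a : tail_space rho C a0 b) : nat -> R := val a.

End weak_ideal.

Coercion seq_of : tail_space >-> Funclass.

(* tail_space is a metric space for d_rk, which is finite on it. *)
Section tail_metric.
Context {R : realType}.
Variables (rho C : R) (a0 b : nat -> R).
Local Notation K := (tail_space rho C a0 b).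
Implicit Types a : K.

HB.instance Definition _ := Choice.copy K (set_type (tail_class rho C a0 b)).

Lemma tail_class_seq a : tail_class rho C a0 b a.
Proof. exact: set_valP a. Qed.

Lemma weight_gt0 j : 0 < weight rho j.
Proof. by rewrite /weight powR_gt0. Qed.

Lemma weighted_le a j : weight rho j * a j <= C.
Proof.
have [[_ _ /(_ j) aC] _] := tail_class_seq a.
have w0 := weight_gt0 j.
move: aC; rewrite powRN -/(weight rho j) -(ler_pM2l w0).
by rewrite mulrCA divff ?gt_eqF// mulr1.
Qed.

Lemma weighted_dist_le a a' j : weight rho j * `|a j - a' j| <= C.
Proof.
have [[_ /(_ j) a_ge0 _] _] := tail_class_seq a.
have [[_ /(_ j) a'_ge0 _] _] := tail_class_seq a'.
have w0 := weight_gt0 j.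
have [aa'|a'a] := leP (a j) (a' j).
- apply: le_trans (weighted_le a' j).
  by rewrite ler_pM2l// ler0_norm ?subr_le0// opprB gerBl.
- apply: le_trans (weighted_le a j).
  by rewrite ler_pM2l// gtr0_norm ?subr_gt0// gerBl.
Qed.

Lemma d_rk_fin_num a a' : d_rk rho a a' \is a fin_num.
Proof.
rewrite ge0_fin_numE.
  apply: (@le_lt_trans _ _ C%:E); last exact: ltry.
  by apply: ge_ereal_sup => _ [j _ <-]; rewrite lee_fin weighted_dist_le.
apply: (@le_trans _ _ (weight rho 0 * `|a 0%N - a' 0%N|)%:E).
  by rewrite lee_fin mulr_ge0// ltW// weight_gt0.
by apply: ereal_sup_ubound; exists 0%N.
Qed.

Lemma d_rk_ub a a' j : weight rho j * `|a j - a' j| <= fine (d_rk rho a a').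
Proof.
rewrite -lee_fin fineK ?d_rk_fin_num//.
by apply: ereal_sup_ubound; exists j.
Qed.

Lemma d_rk_le a a' (r : R) :
  (forall j, weight rho j * `|a j - a' j| <= r) -> fine (d_rk rho a a') <= r.
Proof.
move=> ler; rewrite -lee_fin fineK ?d_rk_fin_num//.
by apply: ge_ereal_sup => _ [j _ <-]; rewrite lee_fin.
Qed.

Let dist a a' : R := fine (d_rk rho a a').

Let distxx a : dist a a = 0.
Proof.
apply/eqP; rewrite eq_le; apply/andP; split.
  by apply: d_rk_le => j; rewrite subrr normr0 mulr0.
by have := d_rk_ub a a 0; rewrite subrr normr0 mulr0.
Qed.

Let dist_positivity a a' : dist a a' = 0 -> a = a'.
Proof.
move=> aa'0; apply: val_inj; apply/funext => j; apply/eqP.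
have := d_rk_ub a a' j; rewrite -/(dist a a') aa'0 => le0.
rewrite -subr_eq0 -normr_le0.
by move: le0; rewrite pmulr_rle0// weight_gt0.
Qed.

Let dist_sym a a' : dist a a' = dist a' a.
Proof. by rewrite /dist /d_rk; under eq_fun do rewrite distrC. Qed.

Let dist_triangle a' a a'' : dist a a'' <= dist a a' + dist a' a''.
Proof.
apply: d_rk_le => j; apply: le_trans (lerD (d_rk_ub a a' j) (d_rk_ub a' a'' j)).
by rewrite -mulrDr ler_pM2l ?weight_gt0// ler_distD.
Qed.

HB.instance Definition _ :=
  isMetric.Build R K distxx dist_positivity dist_sym dist_triangle.

Lemma mdist_d_rk a a' : (mdist a a')%:E = d_rk rho a a'.
Proof. by apply: fineK; exact: d_rk_fin_num. Qed.

End tail_metric.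

Definition inv_map (R : realType) (rho C : R) (a0 b : nat -> R)
  (a : tail_space rho C a0 b) : {ptws nat -> R} := E_inv C a.

(* Main.v *)
Require Import Defs.
From HB Require Import structures.
From mathcomp Require Import all_boot all_order all_algebra.
From mathcomp Require Import finmap ring lra.
From mathcomp Require Import all_classical all_reals all_analysis measurable_realfun.

(** Everything rests on one estimate: for a, a' in the weak class and n >= 1,
    every entry satisfies |a_j - a'_j| <= C H_n(a, a').

    With x_j = (a_j / C)^2 and x'_j likewise, the sums of the x_j and of the
    x'_j are at most S_rho, by comparison with the series of j^(-2/rho).
    Suppose s = x'_j < x_j = r, and let f be the function that vanishes up to
    s, has slope 1 from s to r, and equals r (r - s) / t for t >= r.  Then
    t f(t) is at most r (r - s) everywhere and equal to it from r on, so the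
    sum of the x_i f(x_i) is at least j + 1 times r (r - s) (with indices from
    0), and the one for x' at most j times it.  Hence (r - s)^2 <= r (r - s)
    is bounded by the difference of the integrals of f against mu_x and mu_x'.
    Replacing the 2-Lipschitz function f by its Bernstein polynomial of degree
    n costs at most 2 S_rho / n^(1/2) for each measure, and the integrals of
    the Bernstein polynomial differ by at most q_n.  This bounds
    |x_j - x'_j|^2, hence also |a_j / C - a'_j / C|^4
    (lemmas [gap_bound], [sqs_gap_le], [entry_dist_le]).

    The rest is soft.  The tails of two elements of the class differ by at
    most 2 b_M, so bounds on the first M entries control the rank distance
    ([d_rk_le_max]); this gives both displayed inequalities and the equality
    of the uniformities.  For the same reason, coordinatewise convergence is
    metric convergence, and a limit of an ultrafilter taken coordinate by
    coordinate proves compactness.  The map J is injective because Newton's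
    identities recover the power sums, hence the moments beta_{k,n}, from the
    elementary symmetric functions, so that q_n = 0 for all n
    ([E_inv_inj]); it is continuous because each E_k is Lipschitz
    ([inv_map_lipschitz]).  A continuous injection of a compact space into a
    Hausdorff uniform space has closed range and a uniformly continuous
    inverse ([compact_injective_unif_inverse]).

    Elementary symmetric functions, power sums and moments are all handled as
    limits of the corresponding finite sums over the first N entries. *)

Set Implicit Arguments.
Unset Strict Implicit.
Unset Printing Implicit Defensive.

Import Order.TTheory GRing.Theory Num.Theory.
Import numFieldNormedType.Exports.

Local Open Scope classical_set_scope.
Local Open Scope ring_scope.

(** * Sums of negative powers *)

(** Comparison with the integral of t^(-s): the tail from N on is kept as
    N^(1-s) / (s-1), which makes the bound provable by induction. *)
Lemma sum_zeta_le {R : realType} (s : R) (N : nat) : 1 < s ->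
  \sum_(j < N) j.+1%:R `^ (- s) <= s / (s - 1).
Proof.
move=> s1; have s10 : 0 < s - 1 by rewrite subr_gt0.
case: N => [|N].
  by rewrite big_ord0 divr_ge0// ltW// (lt_trans _ s1).
suff : \sum_(j < N.+1) j.+1%:R `^ (- s) <=
    s / (s - 1) - N.+1%:R `^ (1 - s) / (s - 1).
  move/le_trans; apply; rewrite gerBl divr_ge0 ?powR_ge0//; exact: ltW.
elim: N => [|N IH].
  rewrite big_ord_recr big_ord0 /= add0r !powR1 -mulrBl divff//.
  by rewrite gt_eqF.
rewrite big_ord_recr /=; apply: le_trans (lerD IH (lexx _)) _.
set u : R := N.+2%:R; have u0 : 0 < u by rewrite /u.
have -> : N.+1%:R = u * (1 - u^-1) :> R.
  by rewrite mulrBr mulr1 divff ?gt_eqF// /u -(natr1 N.+1) addrK.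
have u1 : u^-1 < 1 by rewrite invf_lt1// /u ltr1n.
have v0 : 0 < 1 - u^-1 by rewrite subr_gt0.
rewrite powRM ?(ltW u0) ?(ltW v0)//.
have -> : u `^ (- s) = u `^ (1 - s) / u.
  by rewrite powRD ?(gt_eqF u0) ?implybT// powRr1 ?(ltW u0)// mulrAC divff ?mul1r ?gt_eqF.
set w := u `^ (1 - s); have w0 : 0 <= w by rewrite powR_ge0.
(* Bernoulli's inequality for the exponent 1 - s < 0 *)
have bern : 1 + (s - 1) / u <= (1 - u^-1) `^ (1 - s).
  rewrite /powR gt_eqF//; apply: le_trans (expR_ge1Dx _).
  rewrite lerD2l -[1 - s]opprB mulNr -mulrN ler_wpM2l ?(ltW s10)//.
  by rewrite lerNr; apply: le_ln1Dx; rewrite ltrN2 u1.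
rewrite -!addrA lerD2l -subr_ge0.
have -> : - (w / (s - 1)) - (- (w * (1 - u^-1) `^ (1 - s) / (s - 1)) + w / u) =
  w / (s - 1) * ((1 - u^-1) `^ (1 - s) - (1 + (s - 1) / u)).
  by field; rewrite gt_eqF ?gt_eqF.
by rewrite mulr_ge0 ?divr_ge0 ?(ltW s10)// subr_ge0.
Qed.

(** * Bernstein polynomials *)

Section bernstein.
Context {R : realFieldType}.
Implicit Types (t : R) (g : nat -> R) (n k : nat).

Definition bernp n k t : R := 'C(n, k)%:R * t ^+ k * (1 - t) ^+ (n - k).

Lemma bernp_ge0 n k t : 0 <= t <= 1 -> 0 <= bernp n k t.
Proof.
move=> /andP[t0 t1].
by rewrite !mulr_ge0 ?ler0n ?exprn_ge0 ?subr_ge0.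
Qed.

(** Conditioning a binomial variable on its last trial. *)
Lemma sum_bernpS g n t :
  \sum_(k < n.+2) g k * bernp n.+1 k t =
  t * (\sum_(k < n.+1) g k.+1 * bernp n k t) +
  (1 - t) * (\sum_(k < n.+1) g k * bernp n k t).
Proof.
have -> : \sum_(k < n.+2) g k * bernp n.+1 k t =
    \sum_(k < n.+2) g k * (if (k : nat) is k'.+1 then t * bernp n k' t else 0)
    + \sum_(k < n.+2) g k * ((1 - t) * bernp n k t *+ (k <= n)%N).
  rewrite -big_split /=; apply: eq_bigr => -[[|k] kn] _ /=; rewrite /bernp.
    by rewrite !bin0 !subn0 /= mulr0 add0r mulr1n exprS; ring.
  rewrite -mulrDr; congr (_ * _); rewrite binS natrD subSS exprS.
  case: (ltnP k n) => kn'; last by rewrite bin_small//; ring.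
  by rewrite mulr1n -[in LHS](subnSK kn') -[in RHS](subnSK kn') !exprS; ring.
rewrite [X in X + _]big_ord_recl mulr0 add0r.
rewrite [X in _ + X]big_ord_recr /= ltnn mulr0n mulr0 addr0 !mulr_sumr.
by congr (_ + _); apply: eq_bigr => k _; rewrite ?leq_ord ?mulr1n ?lift0; ring.
Qed.

Lemma sum_bernp n t : \sum_(k < n.+1) bernp n k t = 1.
Proof.
elim: n => [|n IH].
  by rewrite big_ord_recr big_ord0 /= /bernp !expr0 bin0; ring.
have := sum_bernpS (fun=> 1) n t.
under eq_bigr do rewrite mul1r.
move=> ->; under eq_bigr do rewrite mul1r.
by rewrite IH; ring.
Qed.

(** The variance of the binomial law grows by t (1 - t) with each trial: on
    splitting off the last trial the first-order terms cancel. *)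
Lemma bernp_variance n t :
  \sum_(k < n.+1) (k%:R - n%:R * t) ^+ 2 * bernp n k t = n%:R * (t * (1 - t)).
Proof.
elim: n => [|n IH].
  by rewrite big_ord_recr big_ord0 /= /bernp !expr0 bin0; ring.
rewrite (sum_bernpS (fun k => (k%:R - n.+1%:R * t) ^+ 2)) !mulr_sumr -big_split /=.
transitivity (\sum_(k < n.+1) ((k%:R - n%:R * t) ^+ 2 * bernp n k t +
    t * (1 - t) * bernp n k t)).
  by apply: eq_bigr => k _; rewrite -!natr1; ring.
by rewrite big_split /= IH -mulr_sumr sum_bernp -natr1; ring.
Qed.

End bernstein.

(** The bound |u - v| <= (n^(1/2) (u - v)^2 + n^(-1/2)) / 2 trades
    the first absolute moment, which has no closed form, for the variance. *)
Lemma bernstein_approx {R : realType} (f : R -> R) (n : nat) (t : R) :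
  (0 < n)%N -> 0 <= t <= 1 ->
  (forall u v, `|f u - f v| <= 2 * `|u - v|) ->
  `|\sum_(k < n.+1) f (k%:R / n%:R) * bernp n k t - f t|
    <= 2 / Num.sqrt n%:R.
Proof.
move=> n0 t01 lipf.
have nR : 0 < n%:R :> R by rewrite ltr0n.
set w : R := Num.sqrt n%:R; have w0 : 0 < w by rewrite sqrtr_gt0.
have w2 : w ^+ 2 = n%:R by rewrite sqr_sqrtr// ltW.
rewrite -[X in _ - X]mulr1 -[X in _ * X](sum_bernp n t) mulr_sumr -sumrB.
apply: le_trans (ler_norm_sum _ _ _) _.
have step (k : 'I_n.+1) : true ->
    `|f (k%:R / n%:R) * bernp n k t - f t * bernp n k t| <=
    w ^- 3 * ((k%:R - n%:R * t) ^+ 2 * bernp n k t) + w^-1 * bernp n k t.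
  move=> _; rewrite -mulrBl normrM (ger0_norm (bernp_ge0 _ _ t01)) [w ^- 3 * _]mulrA -mulrDl.
  apply: ler_wpM2r; first exact: bernp_ge0.
  apply: le_trans (lipf _ _) _.
  set d := k%:R / n%:R - t.
  have -> : k%:R - n%:R * t = w ^+ 2 * d.
    by rewrite /d w2; field; rewrite gt_eqF.
  have -> : w ^- 3 * (w ^+ 2 * d) ^+ 2 = w * `|d| ^+ 2.
    by rewrite -normrX ger0_norm ?sqr_ge0//; field; rewrite gt_eqF.
  rewrite -(ler_pM2l w0) mulrDr divff ?gt_eqF// -subr_ge0.
  have -> : w * (w * `|d| ^+ 2) + 1 - w * (2 * `|d|) = (w * `|d| - 1) ^+ 2.
    by ring.
  exact: sqr_ge0.
apply: le_trans (ler_sum _ step) _.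
rewrite big_split /= -!mulr_sumr bernp_variance sum_bernp -w2.
have -> : w ^- 3 * (w ^+ 2 * (t * (1 - t))) + w^-1 * 1 = (t * (1 - t) + 1) / w.
  by field; rewrite gt_eqF.
rewrite ler_pM2r ?invr_gt0//.
case/andP: t01 => t0 t1; nra.
Qed.

(** * Comparison of entries through Bernstein moments *)

Section separation.
Context {R : realType}.
Implicit Types (r s t u v S : R) (x : nat -> R) (n k N j : nat).

(** The factor t * plateau s r t climbs from 0 at s to its maximum r (r - s) at
    r and stays there.  Written as a bounded ramp times the ratio
    r / max(t, r), its Lipschitz constant comes from the product rule. *)
Definition plateau s r t : R :=
  Num.max 0 (Num.min t r - s) * (r / Num.max t r).

Lemma max_lipschitz r u v : `|Num.max r u - Num.max r v| <= `|u - v|.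
Proof.
by case: (leP r u) => ?; case: (leP r v) => ?; do ?case: ler0P => ?; lra.
Qed.

Section plateau_properties.
Variables (s r : R) (s_ge0 : 0 <= s) (s_lt_r : s < r) (r_le1 : r <= 1).

Let r_gt0 : 0 < r. Proof. exact: le_lt_trans s_lt_r. Qed.

Let max_gt0 t : 0 < Num.max t r.
Proof. by rewrite lt_max r_gt0 orbT. Qed.

Let ramp_bounds t : 0 <= Num.max 0 (Num.min t r - s) <= r - s.
Proof. by rewrite le_max lexx ge_max /= subr_ge0 (ltW s_lt_r) lerD2r ge_min lexx orbT. Qed.

Let ratio_bounds t : 0 <= r / Num.max t r <= 1.
Proof.
by rewrite divr_ge0 ?(ltW r_gt0) ?(ltW (max_gt0 t))// ler_pdivrMr ?mul1r// le_max lexx orbT.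
Qed.

Lemma plateau_bounds t : 0 <= plateau s r t <= 1.
Proof.
have /andP[m0 mr] := ramp_bounds t; have /andP[h0 h1] := ratio_bounds t.
rewrite /plateau mulr_ge0//= mulr_ile1//.
by rewrite (le_trans mr)// (le_trans _ r_le1)// gerBl.
Qed.

Lemma plateau_eq0 t : t <= s -> plateau s r t = 0.
Proof.
move=> ts; rewrite /plateau max_l ?mul0r// subr_le0.
by rewrite ge_min ts.
Qed.

Lemma mulr_plateau_max t : r <= t -> t * plateau s r t = r * (r - s).
Proof.
move=> rt; rewrite /plateau min_r// [Num.max t r]max_l// max_r ?subr_ge0 ?ltW//.
by field; rewrite gt_eqF// (lt_le_trans r_gt0).
Qed.

Lemma mulr_plateau_le t : 0 <= t -> t * plateau s r t <= r * (r - s).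
Proof.
move=> t0; have [rt|tr] := leP r t; first by rewrite mulr_plateau_max.
have /andP[m0 mr] := ramp_bounds t.
rewrite /plateau [Num.max t r]max_r ?(ltW tr)// divff ?gt_eqF// mulr1.
by apply: ler_pM => //; exact: ltW.
Qed.

Lemma plateau_lipschitz u v : `|plateau s r u - plateau s r v| <= 2 * `|u - v|.
Proof.
rewrite /plateau; set m := Num.max 0 (Num.min u r - s).
set m' := Num.max 0 (Num.min v r - s).
set p := Num.max u r; set q := Num.max v r.
have mm' : `|m - m'| <= `|u - v|.
  rewrite /m /m'; apply: le_trans (max_lipschitz _ _ _) _.
  rewrite opprD addrACA subrr addr0.
  case: (leP u r) => ?; case: (leP v r) => ?; do ?case: ler0P => ?; lra.
have pq : `|p - q| <= `|u - v|.
  by rewrite /p /q ![Num.max _ r]maxC; exact: max_lipschitz.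
have p0 : 0 < p := max_gt0 u; have q0 : 0 < q := max_gt0 v.
have rp : r <= p by rewrite le_max lexx orbT.
have rq : r <= q by rewrite le_max lexx orbT.
have -> : m * (r / p) - m' * (r / q) =
    (m - m') * (r / p) + m' * (r * (q - p) / (p * q)).
  by field; rewrite !gt_eqF.
rewrite mulr_natl mulr2n; apply: le_trans (ler_normD _ _) _; apply: lerD.
  have /andP[h0 h1] := ratio_bounds u.
  by rewrite normrM (ger0_norm h0); apply: le_trans mm'; rewrite ler_piMr.
have /andP[m0 mr] := ramp_bounds v.
rewrite normrM (ger0_norm m0) !normrM (gtr0_norm r_gt0) normfV normrM.
rewrite (gtr0_norm p0) (gtr0_norm q0) mulrA ler_pdivrMr ?mulr_gt0//.
rewrite [X in _ <= X]mulrC mulrA distrC; apply: ler_pM => //.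
- by rewrite mulr_ge0// ltW.
- by apply: ler_pM => //; [exact: ltW|apply: le_trans rp; rewrite (le_trans mr)// gerBl].
Qed.

End plateau_properties.

Definition bern_sum x N n k : R := \sum_(i < N) x i * bernp n k (x i).

Lemma bern_sum_approx x S n N f : (0 < n)%N -> (forall i, 0 <= x i <= 1) ->
  \sum_(i < N) x i <= S ->
  (forall u v, `|f u - f v| <= 2 * `|u - v|) ->
  `|\sum_(k < n.+1) f (k%:R / n%:R) * bern_sum x N n k - \sum_(i < N) x i * f (x i)|
    <= 2 * S / Num.sqrt n%:R.
Proof.
move=> n0 x01 xS lipf.
have -> : \sum_(k < n.+1) f (k%:R / n%:R) * bern_sum x N n k =
    \sum_(i < N) x i * \sum_(k < n.+1) f (k%:R / n%:R) * bernp n k (x i).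
  under eq_bigr do rewrite mulr_sumr.
  rewrite exchange_big /=; apply: eq_bigr => i _.
  by rewrite mulr_sumr; apply: eq_bigr => k _; rewrite mulrCA.
rewrite -sumrB; apply: le_trans (ler_norm_sum _ _ _) _.
apply: (@le_trans _ _ (\sum_(i < N) x i * (2 / Num.sqrt n%:R))).
  apply: ler_sum => i _; have /andP[x0 x1] := x01 i.
  rewrite -mulrBr normrM (ger0_norm x0); apply: ler_wpM2l => //.
  exact: bernstein_approx.
rewrite -mulr_suml mulrC mulrAC; apply: ler_wpM2r.
  by rewrite invr_ge0 sqrtr_ge0.
by rewrite ler_wpM2l.
Qed.

(** Each x_i with i <= j contributes r (r - s) to the sum of x_i f(x_i), while
    only the x'_i with i < j contribute at all, and at most r (r - s) each. *)
Lemma gap_bound_lt x x' S n N j : (0 < n)%N -> (j < N)%N ->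
  (forall i, 0 <= x i <= 1) -> (forall i, 0 <= x' i <= 1) ->
  (forall i k, (i <= k)%N -> x k <= x i) ->
  (forall i k, (i <= k)%N -> x' k <= x' i) ->
  \sum_(i < N) x i <= S -> \sum_(i < N) x' i <= S -> x' j < x j ->
  (x j - x' j) ^+ 2 <=
  \sum_(k < n.+1) `|bern_sum x N n k - bern_sum x' N n k|
    + 4 * S / Num.sqrt n%:R.
Proof.
move=> n0 jN x01 x'01 xd x'd xS x'S jx.
set s := x' j; set r := x j.
have /andP[s0 _] := x'01 j; have /andP[_ r1] := x01 j.
pose f := plateau s r.
have lipf : forall u v, `|f u - f v| <= 2 * `|u - v| := plateau_lipschitz s0 jx.
set c := r * (r - s).
have r0 : 0 < r by exact: le_lt_trans s0 jx.
have c0 : 0 < c by rewrite mulr_gt0// subr_gt0.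
have term0 (y : nat -> R) i : 0 <= y i <= 1 -> 0 <= y i * f (y i).
  by move=> /andP[y0 _]; have /andP[? _] := plateau_bounds s0 jx r1 (y i); exact: mulr_ge0.
have low : c *+ j.+1 <= \sum_(i < N) x i * f (x i).
  rewrite -(subnKC jN) big_split_ord /=.
  rewrite -[leLHS]addr0; apply: lerD; last by apply: sumr_ge0 => i _; exact: term0.
  rewrite -[leLHS](_ : \sum_(i < j.+1) c = _); last by rewrite sumr_const card_ord.
  apply: ler_sum => i _; rewrite mulr_plateau_max//.
  by apply: xd; rewrite -ltnS.
have upp : \sum_(i < N) x' i * f (x' i) <= c *+ j.
  rewrite -(subnKC (ltnW jN)) big_split_ord /= [X in _ + X]big1 ?addr0 => [|i _].
    rewrite -[leRHS](_ : \sum_(i < j) c = _); last by rewrite sumr_const card_ord.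
    apply: ler_sum => i _; apply: mulr_plateau_le => //.
    by have /andP[] := x'01 i.
  by rewrite /f plateau_eq0 ?mulr0//; apply: x'd; rewrite leq_addr.
have a1 := bern_sum_approx n0 x01 xS lipf.
have a2 := bern_sum_approx n0 x'01 x'S lipf.
have mid : \sum_(k < n.+1) f (k%:R / n%:R) * bern_sum x N n k -
    \sum_(k < n.+1) f (k%:R / n%:R) * bern_sum x' N n k <=
    \sum_(k < n.+1) `|bern_sum x N n k - bern_sum x' N n k|.
  rewrite -sumrB; apply: ler_sum => k _; rewrite -mulrBr.
  apply: le_trans (ler_norm _) _; rewrite normrM ler_piMl//.
  have /andP[f0 f1] := plateau_bounds s0 jx r1 (k%:R / n%:R).
  by rewrite ger0_norm.
have dc : (r - s) ^+ 2 <= c.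
  by rewrite expr2 ler_wpM2r ?subr_ge0 ?(ltW jx)// gerBl.
have -> : 4 * S / Num.sqrt n%:R = 2 * S / Num.sqrt n%:R + 2 * S / Num.sqrt n%:R.
  by rewrite -mulrDl -mulrDl -natrD.
move: a1 a2; rewrite !ler_norml => /andP[a1 _] /andP[_ a2].
rewrite mulrS in low.
lra.
Qed.

Lemma gap_bound x x' S n N j : (0 < n)%N -> (j < N)%N ->
  (forall i, 0 <= x i <= 1) -> (forall i, 0 <= x' i <= 1) ->
  (forall i k, (i <= k)%N -> x k <= x i) ->
  (forall i k, (i <= k)%N -> x' k <= x' i) ->
  \sum_(i < N) x i <= S -> \sum_(i < N) x' i <= S ->
  (x j - x' j) ^+ 2 <=
  \sum_(k < n.+1) `|bern_sum x N n k - bern_sum x' N n k|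
    + 4 * S / Num.sqrt n%:R.
Proof.
move=> n0 jN x01 x'01 xd x'd xS x'S.
have [jx|jx|jx] := ltgtP (x' j) (x j).
- exact: gap_bound_lt.
- rewrite -sqrrN opprB; under eq_bigr do rewrite distrC.
  exact: gap_bound_lt.
rewrite jx subrr expr0n /= addr_ge0 ?sumr_ge0// divr_ge0 ?sqrtr_ge0// mulr_ge0//.
apply: le_trans xS; apply: sumr_ge0 => i _; by have /andP[] := x01 i.
Qed.

End separation.

(** * Sequences of the weak class *)

Section weak_class.
Context {R : realType}.
Variables (rho C : R) (rho_gt0 : 0 < rho) (rho_lt2 : rho < 2) (C_gt0 : 0 < C).
Implicit Types (a : nat -> R) (i j k n M N : nat).

Lemma weight_ge1 j : 1 <= weight rho j.
Proof.
apply: (@le_trans _ _ (1 `^ rho^-1)); first by rewrite powR1.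
apply: ge0_ler_powR; rewrite ?nnegrE ?ler1n ?ler0n//.
by rewrite invr_ge0 ltW.
Qed.

Lemma weight_homo : {homo weight rho : i j / (i <= j)%N >-> i <= j}.
Proof.
move=> i j ij; apply: ge0_ler_powR; rewrite ?nnegrE//.
- by rewrite invr_ge0 ltW.
- by rewrite ler_nat.
Qed.

Lemma sum_weight_le N : \sum_(j < N) (weight rho j)^-1 ^+ 2 <= S_const rho.
Proof.
have -> : S_const rho = (2 / rho) / (2 / rho - 1).
  by rewrite /S_const; field; rewrite mulN1r !gt_eqF ?subr_gt0.
have -> : \sum_(j < N) (weight rho j)^-1 ^+ 2 =
    \sum_(j < N) j.+1%:R `^ (- (2 / rho)).
  apply: eq_bigr => j _.
  by rewrite /weight -powRN -powR_mulrn ?powR_ge0// -powRrM mulNr mulrC.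
by apply: sum_zeta_le; rewrite ltr_pdivlMr// mul1r.
Qed.

Section member.
Variables (a : nat -> R) (a_class : weak_class rho C a).

Lemma class_ge0 j : 0 <= a j.
Proof. by have [] := a_class. Qed.

Lemma class_weight_le j : a j / C <= (weight rho j)^-1.
Proof.
have [_ _ /(_ j)] := a_class.
by rewrite powRN -/(weight rho j) ler_pdivrMr// mulrC.
Qed.

Lemma class_ratio_bounds j : 0 <= a j / C <= 1.
Proof.
rewrite divr_ge0 ?class_ge0 ?(ltW C_gt0)//=.
by rewrite (le_trans (class_weight_le j))// invf_le1 ?weight_ge1 ?weight_gt0.
Qed.

Lemma sqs_bounds j : 0 <= sqs C a j <= 1.
Proof.
have /andP[a0 a1] := class_ratio_bounds j.
by rewrite /sqs sqr_ge0 expr_le1.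
Qed.

Lemma sqs_ge0 j : 0 <= sqs C a j.
Proof. exact: sqr_ge0. Qed.

Lemma sqs_nonincreasing i j : (i <= j)%N -> sqs C a j <= sqs C a i.
Proof.
move=> ij; rewrite /sqs ler_sqr ?nnegrE.
- by rewrite ler_pM2r ?invr_gt0//; have [H _ _] := a_class; exact: H.
- by have /andP[] := class_ratio_bounds j.
- by have /andP[] := class_ratio_bounds i.
Qed.

Lemma sum_sqs_le N : \sum_(j < N) sqs C a j <= S_const rho.
Proof.
apply: le_trans (sum_weight_le N); apply: ler_sum => j _.
have /andP[a0 _] := class_ratio_bounds j.
rewrite /sqs ler_sqr ?nnegrE ?invr_ge0 ?(ltW (weight_gt0 _ _))//.
exact: class_weight_le.
Qed.

End member.

(** Since x - x' = (alpha - alpha') (alpha + alpha') with alpha = a / C, both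
    factors decay like j^(-1/rho), and their product is summable. *)
Lemma sum_sqs_dist_le a a' (d : R) N :
  weak_class rho C a -> weak_class rho C a' ->
  (forall j, weight rho j * `|a j - a' j| <= d) ->
  \sum_(j < N) `|sqs C a j - sqs C a' j| <= 2 * S_const rho / C * d.
Proof.
move=> ca ca' aa'd.
have d0 : 0 <= d.
  by apply: le_trans (aa'd 0%N); rewrite mulr_ge0// ltW// weight_gt0.
have -> : 2 * S_const rho / C * d = S_const rho * (2 * d / C).
  by field; rewrite gt_eqF.
apply: (@le_trans _ _ (\sum_(j < N) (weight rho j)^-1 ^+ 2 * (2 * d / C))).
  apply: ler_sum => j _; rewrite /sqs subr_sqr normrM.
  have -> : (weight rho j)^-1 ^+ 2 * (2 * d / C) =
     (d / weight rho j / C) * ((weight rho j)^-1 + (weight rho j)^-1).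
    by field; rewrite !gt_eqF ?weight_gt0.
  apply: ler_pM => //.
    have Ci_gt0 : 0 < C^-1 by rewrite invr_gt0.
    rewrite -mulrBl normrM (gtr0_norm Ci_gt0) ler_pM2r// ler_pdivlMr ?weight_gt0// mulrC; exact: aa'd.
  have /andP[a0 _] := class_ratio_bounds ca j.
  have /andP[a'0 _] := class_ratio_bounds ca' j.
  by rewrite ger0_norm ?addr_ge0// lerD// class_weight_le.
rewrite -mulr_suml; apply: ler_wpM2r (sum_weight_le N).
by rewrite divr_ge0 ?mulr_ge0 ?(ltW C_gt0).
Qed.

End weak_class.

(** * Elementary symmetric functions *)

Section elementary_symmetric.
Context {R : realType}.
Implicit Types (x y : nat -> R) (S D : R) (i j k N : nat).

(** This is e_k(x_0, ..., x_{N-1}): each k-element set of indices is counted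
    at its largest element j. *)
Fixpoint esymp x k N : R :=
  if k is k'.+1 then \sum_(j < N) x j * esymp x k' j else 1.

Lemma esympS x k N : esymp x k.+1 N.+1 = esymp x k.+1 N + x N * esymp x k N.
Proof. by rewrite /= big_ord_recr. Qed.

Section nonnegative.
Variables (x : nat -> R) (x_ge0 : forall j, 0 <= x j).

Lemma esymp_ge0 k N : 0 <= esymp x k N.
Proof.
elim: k N => [|k IH] N //=.
by apply: sumr_ge0 => j _; rewrite mulr_ge0.
Qed.

Lemma esymp_le S k N : (forall M, \sum_(j < M) x j <= S) ->
  esymp x k N <= S ^+ k.
Proof.
move=> xS; elim: k N => [|k IH] N /=; first by rewrite expr0.
have S0 : 0 <= S by have := xS 0%N; rewrite big_ord0.
apply: (@le_trans _ _ (\sum_(j < N) x j * S ^+ k)).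
  by apply: ler_sum => j _; rewrite ler_wpM2l.
by rewrite -mulr_suml exprS ler_wpM2r// exprn_ge0.
Qed.

End nonnegative.

Lemma esymp_lipschitz x y S D k N :
  (forall j, 0 <= x j) -> (forall j, 0 <= y j) ->
  (forall M, \sum_(j < M) x j <= S) -> (forall M, \sum_(j < M) y j <= S) ->
  (forall M, \sum_(j < M) `|x j - y j| <= D) ->
  `|esymp x k N - esymp y k N| <= k%:R * S ^+ k.-1 * D.
Proof.
move=> x0 y0 xS yS xyD.
have S0 : 0 <= S by have := xS 0%N; rewrite big_ord0.
have D0 : 0 <= D by have := xyD 0%N; rewrite big_ord0.
elim: k N => [|k IH] N /=; first by rewrite subrr normr0 !mul0r.
rewrite -sumrB; apply: le_trans (ler_norm_sum _ _ _) _.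
apply: (@le_trans _ _ (\sum_(j < N) (x j * (k%:R * S ^+ k.-1 * D) +
    `|x j - y j| * S ^+ k))).
  apply: ler_sum => j _.
  have -> : x j * esymp x k j - y j * esymp y k j =
     x j * (esymp x k j - esymp y k j) + (x j - y j) * esymp y k j by ring.
  apply: le_trans (ler_normD _ _) _; rewrite !normrM (ger0_norm (x0 j)).
  rewrite (ger0_norm (esymp_ge0 y0 k j)).
  by rewrite lerD ?ler_wpM2l//; exact: esymp_le.
rewrite big_split /= -!mulr_suml.
have -> : k.+1%:R * S ^+ k * D = S * (k%:R * S ^+ k.-1 * D) + D * S ^+ k.
  rewrite -natr1; case: k {IH} => [|k]; last by rewrite exprS; ring.
  by rewrite !mul0r mulr0; ring.
by apply: lerD; apply: ler_wpM2r; rewrite ?(mulr_ge0, exprn_ge0)//; [exact: xS|exact: xyD].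
Qed.

(** Newton's identity.  Adjoining one more variable y changes the right-hand
    side by y times the identity for k, that is by k y e_k, and by a
    telescoping sum equal to y e_k. *)
Lemma newton x k N : k.+1%:R * esymp x k.+1 N =
  \sum_(i < k.+1) (-1) ^+ i * esymp x (k - i) N * \sum_(j < N) x j ^+ i.+1.
Proof.
elim: N k => [|N IH] k.
  by rewrite /= big_ord0 mulr0 big1// => i _; rewrite big_ord0 mulr0.
rewrite esympS mulrDr IH; set y := x N.
have pS i : \sum_(j < N.+1) x j ^+ i = \sum_(j < N) x j ^+ i + y ^+ i.
  by rewrite big_ord_recr.
under [RHS]eq_bigr do rewrite pS.
case: k => [|k].
  by rewrite !big_ord_recr !big_ord0 /= !expr0; ring.
rewrite [RHS]big_ord_recr [X in X + _]big_ord_recr /= subnn /=.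
pose t i := (-1) ^+ i * esymp x (k.+1 - i) N * y ^+ i.+1.
have -> : \sum_(i < k.+1) (-1) ^+ i * esymp x (k.+1 - i) N.+1 *
      (\sum_(j < N) x j ^+ i.+1 + y ^+ i.+1) =
    \sum_(i < k.+1) (-1) ^+ i * esymp x (k.+1 - i) N * \sum_(j < N) x j ^+ i.+1 +
    y * \sum_(i < k.+1) (-1) ^+ i * esymp x (k - i) N * \sum_(j < N) x j ^+ i.+1 -
    \sum_(i < k.+1) (t i.+1 - t i).
  rewrite mulr_sumr -sumrN -!big_split /=; apply: eq_bigr => i _.
  rewrite /t subSS (subSn (leq_ord i)) esympS !exprS -/y; ring.
rewrite -(big_mkord xpredT (fun i => t i.+1 - t i)) telescope_sumr//.
rewrite -IH /t subn0 subnn /= expr0 expr1 -!natr1; ring.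
Qed.

End elementary_symmetric.

Lemma ge0_esumZl {R : realType} {T : choiceType} (P : set T) (r : R)
    (a : T -> \bar R) : 0 <= r -> (forall i, 0 <= a i)%E ->
  (\esum_(i in P) (r%:E * a i) = r%:E * \esum_(i in P) a i)%E.
Proof.
move=> r0 a0; rewrite /esum -ereal_supZl//; last first.
  by apply/set0P; exists (\sum_(i \in set0) a i)%E, set0 => //; exact: fsets_set0.
congr ereal_sup; rewrite image_comp; apply: eq_imagel => A _ /=.
by rewrite ge0_mule_fsumr.
Qed.

Section elementary_symmetric_esum.
Context {R : realType}.
Variables (x : nat -> R) (x_ge0 : forall j, 0 <= x j).
Implicit Types (A B : {fset nat}) (J : set nat) (i j k N : nat).
Local Open Scope fset_scope.

Let monomial A : R := \prod_(i <- A) x i.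

Let ksub k N : set {fset nat} :=
  [set A | #|` A| = k /\ forall i, i \in A -> (i < N)%N].

Let ext k j : set {fset nat} := [set j |` A | A in ksub k j].

Let monomial_ge0 A : (0 <= (monomial A)%:E)%E.
Proof. by rewrite lee_fin; apply: prodr_ge0. Qed.

Let fset_max A : A != fset0 ->
  exists2 j, j \in A & forall i, i \in A -> (i <= j)%N.
Proof.
case/fset0Pn => i0 Ai0.
have bounded i : i \in A -> (i <= \max_(j <- A) j)%N.
  by move=> Ai; exact: (leq_bigmax_seq i).
have [j Aj jmax] := ex_maxnP (ex_intro (fun i => i \in A) i0 Ai0) bounded.
by exists j.
Qed.

Let extP k j A : ext k j A <->
  [/\ #|` A| = k.+1, j \in A & forall i, i \in A -> (i <= j)%N].
Proof.
split=> [[B [Bk Bj] <-]|[Ak Aj jmax]].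
  have jB : j \notin B by apply/negP => /Bj; rewrite ltnn.
  split; first by rewrite cardfsU1 jB Bk.
    by rewrite fset1U1.
  by move=> i; rewrite in_fset1U => /predU1P[->//|/Bj/ltnW].
exists (A `\ j); last exact: fsetD1K.
split; first by move: Ak; rewrite (cardfsD1 j) Aj => -[].
by move=> i; rewrite in_fsetD1 => /andP[ij /jmax]; rewrite leq_eqVlt (negPf ij).
Qed.

Let ext_trivIset k : trivIset setT (ext k).
Proof.
move=> i j _ _ [A [/extP[_ Ai imax] /extP[_ Aj jmax]]].
by apply/eqP; rewrite eqn_leq imax// jmax.
Qed.

Let esum_ext k J :
  (forall j, \esum_(A in ksub k j) (monomial A)%:E = (esymp x k j)%:E) ->
  \esum_(A in \bigcup_(j in J) ext k j) (monomial A)%:E =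
  \esum_(j in J) (x j * esymp x k j)%:E.
Proof.
move=> IH; rewrite (@esum_bigcupT _ _ _ (ext k) _ (@ext_trivIset k))//.
apply: eq_esum => j _; rewrite /ext esum_image; last first.
  move=> A B; rewrite !inE => -[_ Aj] [_ Bj] AB.
  have jA : j \notin A by apply/negP => /Aj; rewrite ltnn.
  have jB : j \notin B by apply/negP => /Bj; rewrite ltnn.
  by rewrite -(fsetU1K jA) AB fsetU1K.
rewrite EFinM -IH -ge0_esumZl//; apply: eq_esum => A [_ Aj].
by rewrite /monomial big_fsetU1 ?EFinM//; apply/negP => /Aj; rewrite ltnn.
Qed.

Let esum_ksub k N : \esum_(A in ksub k N) (monomial A)%:E = (esymp x k N)%:E.
Proof.
elim: k N => [|k IH] N.
  have -> : ksub 0 N = [set fset0].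
    apply/seteqP; split=> [A [/cardfs0_eq->]|A ->] //.
  by rewrite esum_set1// /monomial big_seq_fset0.
have -> : ksub k.+1 N = (\bigcup_(j in `I_N) ext k j)%classic.
  apply/seteqP; split=> [A [Ak AN]|A [j jN /extP[Ak Aj jmax]]]; last first.
    by split=> // i /jmax ij; exact: leq_ltn_trans jN.
  have [|j Aj jmax] := @fset_max A; first by rewrite -cardfs_gt0 Ak.
  by exists j; [exact: AN|apply/extP].
rewrite (esum_ext _ IH) esum_fset//; last first.
  by move=> j _; rewrite lee_fin mulr_ge0// esymp_ge0.
by rewrite -fsbig_ord sumEFin.
Qed.

(** The unordered sum over all finite sets, grouped by largest element, is an
    ordinary series whose partial sums are the truncated functions. *)
Lemma esymm_cvg (S : R) k : (forall N, \sum_(j < N) x j <= S) ->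
  esymp x k.+1 N @[N --> \oo] --> esymm x k.+1.
Proof.
move=> xS.
have cvgx : cvgn (esymp x k.+1).
  apply: nondecreasing_is_cvgn.
    apply/nondecreasing_seqP => N.
    by rewrite esympS lerDl mulr_ge0// esymp_ge0.
  by exists (S ^+ k.+1) => _ [N _ <-]; exact: esymp_le.
suff -> : esymm x k.+1 = limn (esymp x k.+1) by [].
have -> : esymm x k.+1 =
    fine (\esum_(A in (\bigcup_(j in [set: nat]) ext k j)%classic) (monomial A)%:E).
  rewrite /esymm; congr (fine (esum _ _)).
  apply/seteqP; split=> [A Ak|A [j _ /extP[]]//].
  have [|j Aj jmax] := @fset_max A; first by rewrite -cardfs_gt0 Ak.
  by exists j => //; apply/extP.
rewrite (esum_ext _ (esum_ksub k)) -nneseries_esumT; last first.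
  by move=> j; rewrite lee_fin mulr_ge0// esymp_ge0.
have -> : (fun N => \sum_(0 <= j < N) (x j * esymp x k j)%:E)%E =
    EFin \o esymp x k.+1.
  by apply/funext => N /=; rewrite big_mkord sumEFin.
by rewrite EFin_lim.
Qed.

End elementary_symmetric_esum.

(** * Moments of the spectral measure *)

Section spectral_measure.
Context {R : realType}.
Variables (C : R) (a : nat -> R).
Implicit Types (g : R -> R) (S : R) (k n N : nat).
Let x := sqs C a.

Lemma ge0_integral_mu_sq g : measurable_fun setT g -> (forall t, 0 <= g t) ->
  (\int[mu_sq C a]_t (g t)%:E = \sum_(j <oo) (x j * g (x j))%:E)%E.
Proof.
move=> mg g0.
have mEg : measurable_fun [set: R] (fun t : R => (g t)%:E) by exact/measurable_EFinP.
rewrite ge0_integral_measure_series//; last by move=> t _; rewrite lee_fin.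
apply: eq_eseriesr => j _.
rewrite ge0_integral_mscale//; last by move=> t _; rewrite lee_fin.
by rewrite integral_dirac//= diracT mul1e.
Qed.

(** Only the values of g at the atoms x_j matter: g may be negative elsewhere,
    but then its negative part integrates to 0. *)
Lemma Rintegral_mu_sq_cvg g S : measurable_fun setT g ->
  (forall j, 0 <= g (x j) <= 1) -> (forall N, \sum_(j < N) x j <= S) ->
  \sum_(j < N) x j * g (x j) @[N --> \oo] --> \int[mu_sq C a]_t g t.
Proof.
move=> mg g01 xS.
have x0 j : 0 <= x j by exact: sqr_ge0.
pose u N := \sum_(j < N) x j * g (x j).
have cvgu : cvgn u.
  apply: nondecreasing_is_cvgn.
    apply/nondecreasing_seqP => N; rewrite /u big_ord_recr /= lerDl.
    by have /andP[? _] := g01 N; exact: mulr_ge0.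
  exists S => _ [N _ <-]; apply: le_trans (xS N); apply: ler_sum => j _.
  by have /andP[_ ?] := g01 j; rewrite ler_piMr.
suff -> : \int[mu_sq C a]_t g t = limn u by [].
rewrite /Rintegral integralE.
rewrite (funerpos g) (funerneg g) !ge0_integral_mu_sq.
- rewrite [X in (_ - X)%E]eseries0 ?sube0; last first.
    move=> j _ _; have /andP[? _] := g01 j.
    by rewrite /funrneg max_r ?mulr0// oppr_le0.
  have -> : (fun N => \sum_(0 <= j < N) (x j * g^\+ (x j))%:E)%E = EFin \o u.
    apply/funext => N /=; rewrite big_mkord sumEFin; congr EFin.
    apply: eq_bigr => j _; have /andP[? _] := g01 j.
    by rewrite /funrpos max_l.
  by rewrite EFin_lim.
- exact: measurable_funrneg.
- exact: funrneg_ge0.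
- exact: measurable_funrpos.
- exact: funrpos_ge0.
Qed.

End spectral_measure.

Section bernstein_moments.
Context {R : realType}.
Implicit Types (C S t : R) (a x : nat -> R) (k n N : nat).

Definition bern_poly n k : {poly R} :=
  'C(n, k)%:R *: 'X^k * (1 - 'X) ^+ (n - k).

Lemma horner_bern_poly n k t : (bern_poly n k).[t] = bernp n k t.
Proof. by rewrite /bern_poly /bernp !hornerE. Qed.

Lemma bernp_le1 n k t : (k <= n)%N -> 0 <= t <= 1 -> bernp n k t <= 1.
Proof.
move=> kn t01; rewrite -(sum_bernp n t).
rewrite (bigD1 (Ordinal (kn : (k < n.+1)%N)))//= lerDl.
by apply: sumr_ge0 => i _; exact: bernp_ge0.
Qed.

Lemma bern_cvg C a S n k : (k <= n)%N -> (forall j, 0 <= sqs C a j <= 1) ->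
  (forall N, \sum_(j < N) sqs C a j <= S) ->
  bern_sum (sqs C a) N n k @[N --> \oo] --> bern C a k n.
Proof.
move=> kn x01 xS; apply: (@Rintegral_mu_sq_cvg _ C a (bernp n k) S _ _ xS).
  have -> : bernp n k = horner (bern_poly n k).
    by apply/funext => t; rewrite horner_bern_poly.
  by apply: continuous_measurable_fun; exact: continuous_horner.
by move=> j; rewrite bernp_ge0// bernp_le1.
Qed.

Lemma bern_sum_power_sums x N n k : bern_sum x N n k =
  \sum_(i < size (bern_poly n k))
    (bern_poly n k)`_i * \sum_(j < N) x j ^+ i.+1.
Proof.
rewrite /bern_sum; under eq_bigr => j _ do
  rewrite -horner_bern_poly horner_coef mulr_sumr.
rewrite exchange_big /=; apply: eq_bigr => i _.
by rewrite mulr_sumr; apply: eq_bigr => j _; rewrite mulrCA exprS.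
Qed.

Lemma cvg_sum_ord m (u : 'I_m -> nat -> R) (l : 'I_m -> R) :
  (forall i, u i N @[N --> \oo] --> l i) ->
  \sum_(i < m) u i N @[N --> \oo] --> \sum_(i < m) l i.
Proof. by move=> ul; apply: cvg_big => //; exact: add_continuous. Qed.

(** Newton's identity expresses the power sum of degree k + 1 polynomially in
    the elementary symmetric functions and the lower power sums, so that its
    limit is a function of the limits E alone. *)
Lemma power_sums_cvg (E : nat -> R) : forall k, exists p : R, forall x,
  (forall i, esymp x i N @[N --> \oo] --> E i) ->
  \sum_(j < N) x j ^+ k.+1 @[N --> \oo] --> p.
Proof.
move=> k; suff /(_ k.+1)[P HP] : forall m, exists P : nat -> R, forall x,
    (forall i, esymp x i N @[N --> \oo] --> E i) ->
    forall i, (i < m)%N -> \sum_(j < N) x j ^+ i.+1 @[N --> \oo] --> P i.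
  by exists (P k) => x xE; exact: HP.
elim=> {k} [|k [P HP]]; first by exists (fun=> 0).
pose p := (-1) ^+ k *
  (k.+1%:R * E k.+1 - \sum_(i < k) (-1) ^+ i * E (k - i)%N * P i).
exists (fun i => if i == k then p else P i) => x xE i.
rewrite ltnS leq_eqVlt; case: eqVneq => /= [-> _|_ ik]; last exact: HP.
have -> : (fun N => \sum_(j < N) x j ^+ k.+1) = (fun N => (-1) ^+ k *
    (k.+1%:R * esymp x k.+1 N -
     \sum_(i < k) (-1) ^+ i * esymp x (k - i) N * \sum_(j < N) x j ^+ i.+1)).
  apply/funext => N; rewrite newton big_ord_recr /= subnn /= mulr1.
  by rewrite addrC addrK mulrA -expr2 sqrr_sign mul1r.
apply: cvgM; first exact: cvg_cst.
apply: cvgB; first by apply: cvgM; [exact: cvg_cst|exact: xE].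
apply: cvg_sum_ord => /= j.
apply: cvgM; last exact: HP.
by apply: cvgM; [exact: cvg_cst|exact: xE].
Qed.

Lemma bern_sum_cvg_eq x y (E : nat -> R) n k :
  (forall i, esymp x i N @[N --> \oo] --> E i) ->
  (forall i, esymp y i N @[N --> \oo] --> E i) ->
  (bern_sum x N n k - bern_sum y N n k) @[N --> \oo] --> (0 : R).
Proof.
move=> xE yE.
have -> : (fun N => bern_sum x N n k - bern_sum y N n k) = fun N =>
    \sum_(i < size (bern_poly n k)) (bern_poly n k)`_i *
      (\sum_(j < N) x j ^+ i.+1 - \sum_(j < N) y j ^+ i.+1).
  apply/funext => N; rewrite !bern_sum_power_sums -sumrB.
  by apply: eq_bigr => i _; rewrite mulrBr.
apply: cvg_trans (_ : _ --> \sum_(i < size (bern_poly n k)) (bern_poly n k)`_i * 0) _.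
  apply: cvg_sum_ord => i; apply: cvgM; first exact: cvg_cst.
  have [p Hp] := power_sums_cvg E i.
  by have := cvgB (Hp x xE) (Hp y yE); rewrite subrr; exact.
by rewrite big1// => i _; rewrite mulr0.
Qed.

End bernstein_moments.

(** * Recovery of the entries from the invariants *)

Section recovery.
Context {R : realType}.
Variables (rho C : R) (rho_gt0 : 0 < rho) (rho_lt2 : rho < 2) (C_gt0 : 0 < C).
Variables (a a' : nat -> R).
Hypotheses (a_class : weak_class rho C a) (a'_class : weak_class rho C a').
Implicit Types (j k n N : nat).

Let x01 := sqs_bounds rho_gt0 C_gt0 a_class.
Let x'01 := sqs_bounds rho_gt0 C_gt0 a'_class.
Let xS := sum_sqs_le rho_gt0 rho_lt2 C_gt0 a_class.
Let x'S := sum_sqs_le rho_gt0 rho_lt2 C_gt0 a'_class.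

Lemma sqs_gap_le n j : (0 < n)%N ->
  (sqs C a j - sqs C a' j) ^+ 2 <=
  q_bern C n a a' + 4 * S_const rho / Num.sqrt n%:R.
Proof.
move=> n0; set e := 4 * S_const rho / _.
pose u N := \sum_(k < n.+1)
  `|bern_sum (sqs C a) N n k - bern_sum (sqs C a') N n k| + e.
have uq : u N @[N --> \oo] --> q_bern C n a a' + e.
  apply: cvgD; last exact: cvg_cst.
  apply: cvg_sum_ord => k; apply: cvg_norm.
  have kn : (k <= n)%N by rewrite -ltnS.
  exact: cvgB (bern_cvg kn x01 xS) (bern_cvg kn x'01 x'S).
rewrite -(cvg_lim _ uq)//; apply: limr_ge; first exact: cvgP uq.
near=> N; apply: gap_bound => //.
- by near: N; exact: nbhs_infty_gt.
- by move=> i k; exact: sqs_nonincreasing a_class _ _.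
- by move=> i k; exact: sqs_nonincreasing a'_class _ _.
Unshelve. all: by end_near. Qed.

(** For nonnegative numbers |alpha - alpha'|^4 <= |alpha^2 - alpha'^2|^2. *)
Lemma entry_dist_le n j : (0 < n)%N ->
  `|a j - a' j| <= C * H_bern rho C n a a'.
Proof.
move=> n0.
have /andP[r0 r1] := class_ratio_bounds rho_gt0 C_gt0 a_class j.
have /andP[r'0 r'1] := class_ratio_bounds rho_gt0 C_gt0 a'_class j.
rewrite -ler_pdivrMl// mulrC.
have Ci_gt0 : 0 < C^-1 by rewrite invr_gt0.
rewrite -[X in _ * X](gtr0_norm Ci_gt0) -normrM mulrBl.
have gap := sqs_gap_le j n0; rewrite /sqs in gap.
set r := a j / C in r0 r1 gap *; set r' := a' j / C in r'0 r'1 gap *.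
rewrite /H_bern le_min; apply/andP; split.
  by rewrite ler_norml; apply/andP; split; lra.
have -> : `|r - r'| = (`|r - r'| ^+ 4) `^ 4^-1.
  by rewrite -powR_mulrn// -powRrM mulfV// powRr1.
apply: ge0_ler_powR; rewrite ?nnegrE ?exprn_ge0 ?invr_ge0//.
  exact: le_trans (sqr_ge0 _) gap.
apply: le_trans gap.
have -> : `|r - r'| ^+ 4 = (r - r') ^+ 2 * (r - r') ^+ 2.
  by rewrite -normrX ger0_norm ?exprn_even_ge0// -exprD.
have -> : (r ^+ 2 - r' ^+ 2) ^+ 2 = (r - r') ^+ 2 * (r + r') ^+ 2 by ring.
rewrite ler_wpM2l ?sqr_ge0// -subr_ge0.
have -> : (r + r') ^+ 2 - (r - r') ^+ 2 = 4 * (r * r') by ring.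
by rewrite mulr_ge0 ?ler0n ?(mulr_ge0 r0 r'0).
Qed.

(** Equal invariants give equal moments, so q_n = 0 for every n, and the error
    4 S / n^(1/2) tends to 0. *)
Lemma E_inv_inj : E_inv C a = E_inv C a' -> a = a'.
Proof.
move=> EE.
pose E k := if k is k'.+1 then E_inv C a k' else 1.
have aE k : esymp (sqs C a) k N @[N --> \oo] --> E k.
  case: k => [|k]; first exact: cvg_cst.
  apply: (esymm_cvg _ xS) => j; exact: sqs_ge0.
have a'E k : esymp (sqs C a') k N @[N --> \oo] --> E k.
  case: k => [|k]; first exact: cvg_cst.
  rewrite /E EE; apply: (esymm_cvg _ x'S) => j; exact: sqs_ge0.
have q0 n : q_bern C n a a' = 0.
  rewrite /q_bern big1// => k _; apply/normr0P/eqP.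
  have kn : (k <= n)%N by rewrite -ltnS.
  have diff : (bern_sum (sqs C a) N n k - bern_sum (sqs C a') N n k)
      @[N --> \oo] --> bern C a k n - bern C a' k n.
    exact: cvgB (bern_cvg kn x01 xS) (bern_cvg kn x'01 x'S).
  rewrite -(cvg_lim (@Rhausdorff R) diff).
  have lim0 := cvg_lim (@Rhausdorff R) (bern_sum_cvg_eq n k aE a'E).
  exact: lim0.
apply/funext => j.
have S0 : 0 <= S_const rho by have := xS 0%N; rewrite big_ord0.
have sq_eq : sqs C a j = sqs C a' j.
  apply/eqP; rewrite -subr_eq0 -sqrf_eq0; set d := (_ - _) ^+ 2.
  rewrite eq_le sqr_ge0 andbT.
  have [//|d0] := leP d 0.
  (* n = (m + 1)^2 with m + 1 > 4 S / d contradicts the bound for n *)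
  pose m := Num.truncn (4 * S_const rho / d).
  have := sqs_gap_le j (isT : (0 < m.+1 ^ 2)%N).
  rewrite q0 add0r natrX sqrtr_sqr normr_nat -/d ler_pdivlMr// mulrC.
  by rewrite -ler_pdivlMr// leNgt truncnS_gt.
have /andP[r0 _] := class_ratio_bounds rho_gt0 C_gt0 a_class j.
have /andP[r'0 _] := class_ratio_bounds rho_gt0 C_gt0 a'_class j.
move/eqP: sq_eq; rewrite /sqs eqrXn2// => /eqP.
by apply: mulIf; rewrite invr_eq0 gt_eqF.
Qed.

End recovery.

(** * Inverses of continuous injections of compact spaces *)

(** If no entourage B works, the pairs outside A whose images are B-close
    generate a filter; a limit (x, y) of a finer ultrafilter has f x = f y, so
    x = y, although A is a neighbourhood of (x, x). *)
Lemma compact_injective_unif_inverse {U V : uniformType} (f : U -> V) :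
  compact [set: U] -> hausdorff_space V -> continuous f -> injective f ->
  forall A : set (U * U), entourage A ->
  exists2 B : set (V * V), entourage B & forall x y, B (f x, f y) -> A (x, y).
Proof.
move=> cU hV cf injf A entA; apply: contrapT => noB.
pose F : set_system (U * U) := filter_from (@entourage V)
  (fun B => [set p | B (f p.1, f p.2) /\ ~ A p]).
have FF : ProperFilter F.
  apply: filter_from_proper.
    apply: filter_from_filter; first by exists setT; exact: entourageT.
    move=> B B' eB eB'; exists (B `&` B'); first exact: filterI.
    by move=> p [[? ?] ?].
  move=> B eB; apply: contrapT => empty; apply: noB; exists B => // x y Bxy.
  by apply: contrapT => nA; apply: empty; exists (x, y).
have cUU : compact [set: U * U] by rewrite -setXTT; exact: compact_setX.
have [G [GU FG]] := ultraFilterLemma FF.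
move: cUU; rewrite compact_ultra => /(_ G GU filterT)[[x y] [_ Gxy]].
have f1 : (f p.1) @[p --> G] --> f x.
  apply: (@cvg_comp _ _ _ fst f G (nbhs x)); last exact: cf.
  exact: cvg_comp Gxy cvg_fst.
have f2 : (f p.2) @[p --> G] --> f y.
  apply: (@cvg_comp _ _ _ snd f G (nbhs y)); last exact: cf.
  exact: cvg_comp Gxy cvg_snd.
have f2x : (f p.2) @[p --> G] --> f x.
  apply/cvg_entourageP => E entE.
  have GE : G [set p | split_ent E (f p.1, f p.2)].
    by apply: FG; exists (split_ent E) => // p [].
  move/cvg_entourageP: f1 => /(_ (split_ent E) (entourage_split_ent entE)) f1.
  apply: (@filterS2 _ G _ _ _ _ _ f1 GE) => p; exact: entourage_split.
have xy : y = x by apply: injf; exact: cvg_unique f2 f2x.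
have GA : G A.
  apply: Gxy; rewrite xy.
  exists (xsection (split_ent A)^-1%relation x, xsection (split_ent A) x).
    by split; apply: nbhs_entourage => //; exact: entourage_inv.
  move=> [p q] [/= /xsectionP px /xsectionP xq].
  exact: (entourage_split x) px xq.
have GnA : G (~` A) by apply: FG; exists setT; [exact: entourageT|move=> p []].
have [p [Ap nAp]] := filter_ex (filterI GA GnA); exact: nAp.
Qed.

(** * The two distances *)

Section distances.
Context {R : realType}.
Variables (rho : R) (rho_gt0 : 0 < rho).
Implicit Types (u : nat -> R) (j k M : nat).

Lemma rearr0_ge u j : ((u j)%:E <= rearr u 0)%E.
Proof.
apply: le_ereal_inf_tmp => _ [t [_ tu] <-]; rewrite lee_fin leNgt; apply/negP => ut.
by move: tu; rewrite II0 card_le0 => /eqP/seteqP[/(_ j ut)].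
Qed.

(** Where w_j |a_j - a'_j| <= D, the entries exceeding D / w_k have index below
    k because w is nondecreasing, so that the k-th rearranged entry is at most
    D / w_k. *)
Lemma d_weak_le_d_rk (a a' : nat -> R) : (d_weak rho a a' <= d_rk rho a a')%E.
Proof.
apply: ge_ereal_sup => _ [k _ <-].
have w0 j : 0 < weight rho j := weight_gt0 rho j.
have Dub j : ((weight rho j * `|a j - a' j|)%:E <= d_rk rho a a')%E.
  by apply: ereal_sup_ubound; exists j.
case: (d_rk rho a a') Dub => [D| |] Dub; last 2 first.
- by rewrite leey.
- by have := Dub 0%N; rewrite leeNy_eq.
have D0 : 0 <= D.
  by rewrite -lee_fin (le_trans _ (Dub 0%N))// lee_fin mulr_ge0// ltW.
rewrite -lee_pdivlMl// -EFinM.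
apply: ereal_inf_lbound; exists ((weight rho k)^-1 * D) => //; split.
  by rewrite mulr_ge0// invr_ge0 ltW.
apply: subset_card_le => j /= Dj; rewrite ltnNge; apply/negP => kj.
have := Dub j; rewrite lee_fin leNgt => /negP[].
apply: lt_le_trans (_ : weight rho k * `|a j - a' j| <= _); last first.
  by rewrite ler_wpM2r// weight_homo.
by rewrite -ltr_pdivrMl.
Qed.

Lemma entry_dist_le_d_weak (a a' : nat -> R) j :
  (`|a j - a' j|%:E <= d_weak rho a a')%E.
Proof.
apply: le_trans (rearr0_ge (fun i => `|a i - a' i|) j) _.
have -> : rearr (fun i => `|a i - a' i|) 0 =
    ((weight rho 0)%:E * rearr (fun i => `|a i - a' i|%R) 0)%E.
  by rewrite /weight powR1 mul1e.
by apply: ereal_sup_ubound; exists 0%N.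
Qed.

Lemma weight_le_powR j M : (j < M)%N -> weight rho j <= M%:R `^ rho^-1.
Proof.
by case: M => // M jM; exact: (weight_homo rho_gt0).
Qed.

Section tail.
Variables (C : R) (a0 b : nat -> R) (a a' : nat -> R).
Hypotheses (Ka : tail_class rho C a0 b a) (Ka' : tail_class rho C a0 b a').

Lemma tail_entry_le (c : nat -> R) M j : tail_class rho C a0 b c ->
  (1 <= M)%N -> (M <= j)%N -> weight rho j * `|c j - a0 j| <= b M.
Proof.
move=> [_ /(_ M) cM] M1 Mj; rewrite -lee_fin; apply: le_trans (cM M1).
by apply: ereal_sup_ubound; exists j.
Qed.

Lemma tail_dist_le M j : (1 <= M)%N -> (M <= j)%N ->
  weight rho j * `|a j - a' j| <= 2 * b M.
Proof.
move=> M1 Mj; have l1 := tail_entry_le Ka M1 Mj.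
have l2 := tail_entry_le Ka' M1 Mj.
rewrite mulr_natl mulr2n; apply: le_trans (lerD l1 l2); rewrite -mulrDr.
rewrite ler_wpM2l ?(ltW (weight_gt0 _ _))//.
by apply: le_trans (ler_distD (a0 j) _ _) _; rewrite [X in _ + X]distrC.
Qed.

(** Beyond M the two tails differ by at most 2 b_M; before M the weight is at
    most M^(1/rho), whatever bound e is available for single entries. *)
Lemma d_rk_le_max M (e : \bar R) : (1 <= M)%N ->
  (forall j, (j < M)%N -> (`|a j - a' j|%:E <= e)%E) ->
  (d_rk rho a a' <= maxe ((M%:R `^ rho^-1)%:E * e) (2 * b M)%:E)%E.
Proof.
move=> M1 ae; apply: ge_ereal_sup => _ [j _ <-]; rewrite le_max.
have [Mj|jM] := leqP M j.
  by apply/orP; right; rewrite lee_fin tail_dist_le.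
apply/orP; left; rewrite EFinM; apply: lee_pmul => //.
- by rewrite lee_fin ltW// weight_gt0.
- by rewrite lee_fin weight_le_powR.
- exact: ae.
Qed.

End tail.
End distances.

(** * The space of sequences with prescribed tails *)

Section tail_space_topology.
Context {R : realType}.
Variables (rho C : R) (a0 b : nat -> R).
Hypotheses (rho_gt0 : 0 < rho) (rho_lt2 : rho < 2) (C_gt0 : 0 < C).
Hypothesis b_cvg0 : b @ \oo --> (0 : R).
Local Notation K := (tail_space rho C a0 b).
Local Notation J := (@inv_map R rho C a0 b).
Implicit Types (a : K) (j k n M N : nat).

Let class_of (a : K) : weak_class rho C a := (tail_class_seq a).1.

Lemma mdist_ub (a a' : K) j : weight rho j * `|a j - a' j| <= mdist a a'.
Proof. by rewrite -lee_fin mdist_d_rk; apply: ereal_sup_ubound; exists j. Qed.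

Lemma mdist_le (a a' : K) (r : R) :
  (forall j, weight rho j * `|a j - a' j| <= r) -> mdist a a' <= r.
Proof.
move=> ar; rewrite -lee_fin mdist_d_rk; apply: ge_ereal_sup => _ [j _ <-].
by rewrite lee_fin.
Qed.

Lemma exists_small_tail (e : R) : 0 < e -> exists2 M, (1 <= M)%N & 2 * b M < e.
Proof.
move=> e0; have e2 : 0 < e / 2 by rewrite divr_gt0.
have [M _ HM] : \forall M \near \oo, b M < e / 2.
  by apply: cvgr_lt b_cvg0 _ e2.
exists (maxn 1 M); first exact: leq_maxl.
by rewrite mulrC -ltr_pdivlMr//; apply: HM => /=; exact: leq_maxr.
Qed.

(** Coordinatewise convergence is convergence for the metric: finitely many
    coordinates converge and all the others are controlled by the tails. *)
Lemma tail_space_cvg (F : set_system K) (l : K) : ProperFilter F ->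
  (forall j, (fun a : K => a j) @ F --> l j) -> F --> l.
Proof.
move=> FF Fl; apply/fcvg_ballP => e e0.
have [M M1 bM] := exists_small_tail e0.
have w0 j : 0 < weight rho j := weight_gt0 rho j.
have e2 : 0 < e / 2 by rewrite divr_gt0.
have head : \forall a \near F, forall j : 'I_M,
    weight rho j * `|l j - (a : K) j| < e / 2.
  apply: filter_forall => j.
  have := Fl j; move/cvgrPdist_lt => /(_ ((weight rho j)^-1 * (e / 2))).
  rewrite mulr_gt0 ?invr_gt0// => /(_ isT); apply: filterS => a.
  by rewrite ltr_pdivlMl.
apply: filterS head => a head; rewrite ballEmdist /=.
apply: le_lt_trans (_ : Num.max (e / 2) (2 * b M) < e); last first.
  by rewrite gt_max bM andbT ltr_pdivrMr// ltr_pMr// ltr1n.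
apply: mdist_le => j; rewrite le_max; have [Mj|jM] := leqP M j.
  by rewrite (tail_dist_le (tail_class_seq l) (tail_class_seq a) M1 Mj) orbT.
by rewrite (ltW (head (Ordinal jM))).
Qed.

(** Along an ultrafilter every coordinate converges in [0, C], and the
    conditions defining the class are closed. *)
Lemma tail_space_compact : compact [set: K].
Proof.
rewrite compact_ultra => F FU _.
have entry_cvg j : exists y : R, (fun a : K => a j) @ F --> y.
  have cpt := @segment_compact R 0 C.
  have F0C : ((fun a : K => a j) @ F) `[0, C]%classic.
    apply: (@filterE _ F) => a /=; rewrite in_itv /=.
    have /andP[r0 r1] := class_ratio_bounds rho_gt0 C_gt0 (class_of a) j.
    rewrite (class_ge0 (class_of a))/=.
    by rewrite ler_pdivrMr// mul1r in r1.
  have [y [_ cly]] := cpt _ _ F0C.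
  exists y => U nU.
  have [//|FnU] := in_ultra_setVsetC (fun a : K => U (a j)) FU.
  have [z [nUz Uz]] := cly (~` U) U FnU nU.
  by [].
have [l Fl] := choice entry_cvg.
have lim_le (g : K -> R) y c : g @ F --> y ->
    (forall a, c <= g a) -> c <= y.
  move=> gy cg; apply: (closed_cvg (fun z => c <= z)) gy; first exact: closed_ge.
  exact: (@filterE _ F).
have Kl : tail_class rho C a0 b l.
  split; first split.
  - move=> i j ij; rewrite -subr_ge0.
    apply: (lim_le _ _ _ (cvgB (Fl i) (Fl j))) => a.
    by rewrite subr_ge0; have [H _ _] := class_of a; exact: H.
  - by move=> j; apply: (lim_le _ _ _ (Fl j)) => a; exact: class_ge0 (class_of a) j.
  - move=> j; rewrite -subr_ge0.
    apply: (lim_le _ _ _ (cvgB (cvg_cst _) (Fl j))) => a.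
    by rewrite subr_ge0; have [_ _ H] := class_of a; exact: H.
  move=> M M1; apply: ge_ereal_sup => _ [j /= Mj <-]; rewrite lee_fin -subr_ge0.
  apply: (lim_le (fun a : K => b M - weight rho j * `|a j - a0 j|)).
    apply: cvgB; first exact: cvg_cst.
    apply: cvgM; first exact: cvg_cst.
    by apply: cvg_norm; apply: cvgB; [exact: Fl|exact: cvg_cst].
  by move=> a; rewrite subr_ge0; exact: tail_entry_le (tail_class_seq a) M1 Mj.
exists (exist _ l (mem_set Kl) : K); split=> //.
exact: tail_space_cvg.
Qed.

(** A Cauchy filter converges to each of its cluster points. *)
Lemma tail_space_complete (F : set_system K) : ProperFilter F -> cauchy F ->
  exists a : K, F --> a.
Proof.
move=> FF cF; have [x [_ clx]] := tail_space_compact FF filterT.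
exists x; apply/fcvg_ballP => e e0.
have e2 : 0 < e / 2 by rewrite divr_gt0.
have entE : entourage [set p : K * K | ball p.1 (e / 2) p.2].
  by rewrite -entourage_from_ballE; exists (e / 2).
have [[D1 D2] [/= FD1 FD2] D12] := cF _ entE.
have [z [Dz xz]] := clx D1 (ball x (e / 2)) FD1 (nbhsx_ballx _ _ e2).
apply: filterS FD2 => t Dt; apply: (ball_split xz).
by apply: (D12 (z, t)).
Qed.

Lemma tail_space_entourage : @entourage K =
  filter_from [set e : R | 0 < e]
    (fun e => [set p : K * K | (d_weak rho p.1 p.2 < e%:E)%E]).
Proof.
rewrite -entourage_from_ballE; apply/seteqP; split=> U [e /= e0 eU].
- have [M M1 bM] := exists_small_tail e0.
  have w0 : 0 < M%:R `^ rho^-1 :> R by rewrite powR_gt0// ltr0n.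
  exists (e / M%:R `^ rho^-1) => /=; first by rewrite divr_gt0.
  move=> [a a'] /= daa'; apply: eU; rewrite /= ballEmdist /= -lte_fin mdist_d_rk.
  apply: le_lt_trans (_ : _ <= maxe ((M%:R `^ rho^-1)%:E * d_weak rho a a')%E
      (2 * b M)%:E)%E _.
    apply: (d_rk_le_max rho_gt0 (tail_class_seq a) (tail_class_seq a') M1) => j _.
    exact: entry_dist_le_d_weak.
  rewrite gt_max lte_fin bM andbT.
  by rewrite -lte_pdivlMl// -EFinM mulrC.
- exists e => // -[a a']; rewrite /= ballEmdist /= => aa'; apply: eU => /=.
  apply: le_lt_trans (d_weak_le_d_rk rho_gt0 a a') _.
  by rewrite -mdist_d_rk lte_fin.
Qed.

Lemma inv_map_lipschitz (a a' : K) k :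
  `|J a k - J a' k| <=
  k.+1%:R * S_const rho ^+ k * (2 * S_const rho / C * mdist a a').
Proof.
rewrite /inv_map /E_inv; set B := (X in _ <= X).
have aS := sum_sqs_le rho_gt0 rho_lt2 C_gt0 (class_of a).
have a'S := sum_sqs_le rho_gt0 rho_lt2 C_gt0 (class_of a').
have diff : `|esymp (sqs C a) k.+1 N - esymp (sqs C a') k.+1 N| @[N --> \oo]
    --> `|esymm (sqs C a) k.+1 - esymm (sqs C a') k.+1|.
  apply: cvg_norm; apply: cvgB; first exact: (esymm_cvg (sqs_ge0 C a) aS).
  exact: (esymm_cvg (sqs_ge0 C a') a'S).
apply: (closed_cvg (fun z => z <= B)) diff; first exact: closed_le.
apply: nearW => N; apply: esymp_lipschitz => //; try exact: sqs_ge0.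
move=> M; apply: sum_sqs_dist_le => //; exact: mdist_ub.
Qed.

Lemma inv_map_continuous : continuous J.
Proof.
move=> a; have JF : Filter (J @ a) by exact: (@fmap_filter _ _ J (nbhs a) (nbhs_filter a)).
apply/(pointwise_cvgP _ JF) => k; apply/cvgrPdist_lt => e e0.
pose L := k.+1%:R * S_const rho ^+ k * (2 * S_const rho / C).
have S0 : 0 <= S_const rho.
  by have := sum_weight_le rho_gt0 rho_lt2 0; rewrite big_ord0.
have L0 : 0 <= L.
  apply: mulr_ge0; first by rewrite mulr_ge0 ?ler0n// exprn_ge0.
  by rewrite divr_ge0 ?(ltW C_gt0)// mulr_ge0.
have L1 : 0 < L + 1 by rewrite ltr_wpDl.
have d0 : 0 < e / (L + 1) by rewrite divr_gt0.
apply: filterS (nbhsx_ballx a _ d0) => a'; rewrite ballEmdist /= => aa'.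
apply: le_lt_trans (inv_map_lipschitz a a' k) _; rewrite mulrA -/L.
move: aa'; rewrite ltr_pdivlMr//; apply: le_lt_trans.
by rewrite mulrC ler_wpM2l ?mdist_ge0// lerDl.
Qed.

Lemma inv_map_injective : injective J.
Proof.
move=> a a' /(E_inv_inj rho_gt0 rho_lt2 C_gt0 (class_of a) (class_of a')) aa'.
exact: val_inj.
Qed.

Lemma closed_range_inv_map : closed (range J).
Proof.
apply: compact_closed; first by apply: hausdorff_product => _; exact: Rhausdorff.
apply: continuous_compact tail_space_compact.
apply: continuous_subspaceT; exact: inv_map_continuous.
Qed.

Lemma inv_map_unif_inverse : exists g : set_type (range J) -> K,
  (forall y, J (g y) = \val y) /\ unif_continuous g.
Proof.
have preimage (y : set_type (range J)) : exists a, J a = \val y.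
  by have [a _ Ja] := set_valP y; exists a.
have [g Jg] := choice preimage; exists g; split=> // A entA.
have [|B entB BA] := compact_injective_unif_inverse tail_space_compact _
  inv_map_continuous inv_map_injective entA.
  by apply: hausdorff_product => _; exact: Rhausdorff.
exists B => // -[y z] /= Byz; apply: BA; rewrite !Jg; exact: Byz.
Qed.

Lemma d_weak_le_max_H_bern n M (a a' : K) : (1 <= n)%N -> (1 <= M)%N ->
  (d_weak rho a a' <=
    (Num.max (M%:R `^ rho^-1 * C * H_bern rho C n a a') (2 * b M))%:E)%E.
Proof.
move=> n1 M1; apply: le_trans (d_weak_le_d_rk rho_gt0 a a') _.
rewrite EFin_max -mulrA EFinM.
apply: (d_rk_le_max rho_gt0 (tail_class_seq a) (tail_class_seq a') M1) => j _.
by rewrite lee_fin; exact: entry_dist_le (class_of a) (class_of a') _ _ n1.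
Qed.

End tail_space_topology.

Unset Implicit Arguments.

Theorem theorem10p9 (R : realType) (rho C : R) (a0 b : nat -> R)
    (rho_gt0 : 0 < rho) (rho_lt2 : rho < 2) (C_gt0 : 0 < C)
    (a0_class : weak_class rho C a0)
    (b_noninc : forall M N : nat, (1 <= M)%N -> (M <= N)%N -> b N <= b M)
    (b_cvg0 : b @ \oo --> (0 : R)) :
  [/\ compact [set: tail_space rho C a0 b] /\
      (forall F : set_system (tail_space rho C a0 b),
         ProperFilter F -> cauchy F ->
         exists a : tail_space rho C a0 b, F --> a),
      @entourage (tail_space rho C a0 b) =
        filter_from [set e : R | 0 < e]
          (fun e => [set p : tail_space rho C a0 b * tail_space rho C a0 b |
                         (d_weak rho p.1 p.2 < e%:E)%E]),
      forall a a' : tail_space rho C a0 b,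
        (d_weak rho a a' <= d_rk rho a a')%E /\
        (d_rk rho a a' <=
           ereal_inf [set maxe ((M%:R `^ rho^-1)%:E * d_weak rho a a')
                               (2 * b M)%:E | M in [set M | (1 <= M)%N]])%E,
      [/\ injective (@inv_map R rho C a0 b),
          closed (range (@inv_map R rho C a0 b)) &
          exists g : set_type (range (@inv_map R rho C a0 b)) ->
                     tail_space rho C a0 b,
            (forall y, inv_map (g y) = \val y) /\ unif_continuous g] &
      forall (n : nat) (a a' : tail_space rho C a0 b), (1 <= n)%N ->
        (d_weak rho a a' <=
           ereal_inf [set (Num.max (M%:R `^ rho^-1 * C * H_bern rho C n a a')
                                   (2 * b M))%:E
                     | M in [set M | (1 <= M)%N]])%E].
Proof.
split.
- by split; [exact: tail_space_compact|exact: tail_space_complete].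
- exact: tail_space_entourage.
- move=> a a'; split; first exact: d_weak_le_d_rk.
  apply: le_ereal_inf_tmp => _ [M M1 <-].
  apply: (d_rk_le_max rho_gt0 (tail_class_seq a) (tail_class_seq a') M1) => j _.
  exact: entry_dist_le_d_weak.
- split; [exact: inv_map_injective|exact: closed_range_inv_map|].
  exact: inv_map_unif_inverse.
- move=> n a a' n1; apply: le_ereal_inf_tmp => _ [M M1 <-].
  exact: d_weak_le_max_H_bern.
Qed.
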